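(* For every integer $d\ge 1$ and every tree $T$, there exists a polynomial $f$ such that for every integer $t\ge 1$ the following holds: if $G\in\mathcal{F}_T(t)$, $G$ is $T$-free, and $G$ does not contain $K_d(t)$ as a subgraph, then $\chi(G)\le f(t)$.
   Context: All graphs are finite and simple. $\chi(G)$ is the chromatic number of $G$. A graph is $T$-free if it has no induced subgraph isomorphic to $T$. For integers $k,t\ge1$, $K_k(t)$ denotes the complete $k$-partite graph in which each of the $k$ parts has exactly $t$ vertices; ''contains $K_k(t)$ as a subgraph'' means as a (not necessarily induced) subgraph. For a graph $G$ and integer $k\ge1$, $\tau_k(G)$ is the largest $t$ such that $G$ contains $K_k(t)$ as a subgraph. For a tree $T$, let $s$ be the maximum degree of $T$, and let $p$ be the minimum, over all vertices $r$ of $T$ of maximum degree, of the height of the rooted tree $(T,r)$ (the number of edges of a longest path in $T$ having $r$ as an endpoint). Define $\beta_T(t)=\big((\sum_{i=0}^{p}s^{i+1})\,t\big)^{(p+3)!\sum_{i=0}^{p}s^{i}}+1$. For a tree $T$ and integer $t\ge1$, $\mathcal{F}_T(t)=\mathcal{F}_1\cup\mathcal{F}_2$, where $\mathcal{F}_1$ is the class of graphs $G$ with $\tau_2(G)<t$, and $\mathcal{F}_2$ is the class of graphs $G$ with $\tau_2(G)\ge t$ such that for every subgraph of $G$ isomorphic to $K_2(\beta_T(t))$, at least one of its two parts (vertex sets of size $\beta_T(t)$) induces in $G$ a graph that contains $K_2(t)$ as a subgraph. *)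

(* Defs.v *)
From mathcomp Require Import all_boot all_order all_algebra.
Set Implicit Arguments. Unset Strict Implicit. Unset Printing Implicit Defensive.
Import Order.TTheory GRing.Theory Num.Theory.

Section Graphs.
Variable V : finType.
Variable E : rel V.

Definition simple_graph : Prop := symmetric E /\ irreflexive E.

Definition containsK_in (A : {set V}) (k t : nat) : bool :=
  [exists f : {ffun 'I_k * 'I_t -> V},
     [&& injectiveb f,
         [forall x, f x \in A] &
         [forall i : 'I_k, forall j : 'I_k, forall a : 'I_t, forall b : 'I_t,
            (i != j) ==> E (f (i, a)) (f (j, b))]]].

Definition containsK (k t : nat) : bool := containsK_in [set: V] k t.

(* tau_k(G): the largest t such that G contains K_k(t) (t <= #|V| always). *)
Definition tau (k : nat) : nat :=
  \max_(t < #|V|.+1 | containsK k t) (t : nat).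

Definition K2_parts (A B : {set V}) (b : nat) : Prop :=
  [disjoint A & B] /\ #|A| = b /\ #|B| = b /\
  (forall x y, x \in A -> y \in B -> E x y).

Definition proper_colorable (k : nat) : bool :=
  [exists c : {ffun V -> 'I_k}, [forall x, forall y, E x y ==> (c x != c y)]].

Definition chi : nat :=
  \big[minn/#|V|]_(k < #|V|.+1 | proper_colorable k) (k : nat).

End Graphs.

Definition T_free (W : finType) (ET : rel W) (V : finType) (E : rel V) : Prop :=
  ~ exists h : W -> V, injective h /\ forall x y, E (h x) (h y) = ET x y.

Section Trees.
Variable W : finType.
Variable ET : rel W.

(* tree: nonempty connected simple graph with #|W| - 1 edges
   (edges counted as ordered pairs, hence the factor 2) *)
Definition is_tree : Prop :=
  simple_graph ET /\ 0 < #|W| /\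
  (forall x y, connect ET x y) /\
  #|[set p : W * W | ET p.1 p.2]| = 2 * (#|W| - 1).

Definition deg (v : W) : nat := #|[set u | ET v u]|.

Definition maxdeg : nat := \max_(v : W) deg v.

Definition height (r : W) : nat :=
  \max_(n < #|W|)
    (if [exists q : n.-tuple W, uniq (r :: q) && path ET r q] then (n : nat) else 0).

Definition hmin : nat :=
  \big[minn/#|W|]_(r : W | deg r == maxdeg) height r.

Definition beta (t : nat) : nat :=
  let s := maxdeg in let p := hmin in
  ((\sum_(i < p.+1) s ^ i.+1) * t) ^ ((p + 3)`! * \sum_(i < p.+1) s ^ i) + 1.

End Trees.

Definition in_FT (W : finType) (ET : rel W) (t : nat) (V : finType) (E : rel V) : Prop :=
  tau E 2 < t \/
  (t <= tau E 2 /\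
   forall A B : {set V}, K2_parts E A B (beta ET t) ->
     containsK_in E A 2 t \/ containsK_in E B 2 t).

(* Main.v *)
Require Import Defs.
From mathcomp Require Import all_boot all_order all_algebra.
From mathcomp Require Import zify.
Set Implicit Arguments. Unset Strict Implicit. Unset Printing Implicit Defensive.

(** Call [u] branching of height [h] and spread [z] if it is the root of a
[z]-ary tree of depth [h] in which every vertex is non-adjacent to its
descendants other than its children (distinct branches are unrestricted).
If [G] has no [K_2(t)], only polynomially many vertices [x] can destroy such a
tree, in the sense that deleting the closed neighbourhood of [x] leaves no tree
of spread [z / 4t]. Two consequences follow. By a double count of edges, the
vertices that are not branching induce a graph of polynomial degeneracy; and
below a branching vertex any tree [T] embeds as an induced subgraph, leaf by
leaf, each time choosing a child that destroys none of the trees still in use.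
So [T]-free graphs without [K_2(t)] have chromatic number polynomial in [t].

In a large set without independent subsets of size [beta], the chromatic
number is large, so the previous result yields a large [K_2(N)]; iterating in
one of its parts yields [K_d(t)]. In a graph of the second class, one of the
two parts of any [K_2(N)] is, up to its size, such a set. Hence a graph in the
class without [K_d(t)] has no [K_2(N)] for some [N] polynomial in [t]. *)

(** * Finite sets and minima *)

Lemma subset_of_card (T : finType) (A : {set T}) (n : nat) :
  n <= #|A| -> exists2 B : {set T}, B \subset A & #|B| = n.
Proof.
elim: n => [|n IHn] nA; first by exists set0; rewrite ?sub0set ?cards0.
have [B sBA cB] := IHn (ltnW nA).
have /card_gt0P[x] : 0 < #|A :\: B|.
  by rewrite cardsD (setIidPr sBA) cB subn_gt0.
rewrite inE => /andP[xB xA]; exists (x |: B).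
  by rewrite subUset sub1set xA.
by rewrite cardsU1 xB cB.
Qed.

Lemma leq_card_bigcup (I T : finType) (A : {set I}) (F : I -> {set T}) :
  #|\bigcup_(i in A) F i| <= \sum_(i in A) #|F i|.
Proof.
elim/big_rec2: _ => [|i n B _ IH]; first by rewrite cards0.
by apply: leq_trans (leq_card_setU _ _) _; rewrite leq_add2l.
Qed.

Lemma bigminn_le (I : eqType) (r : seq I) (P : pred I) (F : I -> nat) (m : nat)
    (j : I) :
  j \in r -> P j -> \big[minn/m]_(i <- r | P i) F i <= F j.
Proof.
move=> + Pj; elim: r => // i r IHr; rewrite inE big_cons => /predU1P[<-|/IHr le].
  by rewrite Pj geq_minl.
by case: ifP => // _; apply: leq_trans (geq_minr _ _) le.
Qed.

(** * Complete multipartite subgraphs *)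

Section Graph.
Variables (V : finType) (E : rel V).
Implicit Types (A B S Z : {set V}) (u v x y : V) (d h k t z : nat).

Lemma containsK_in_add Z A B k t :
  A \subset Z -> B \subset Z -> [disjoint A & B] ->
  (forall x y, x \in A -> y \in B -> E x y /\ E y x) ->
  containsK_in E A k t -> t <= #|B| -> containsK_in E Z k.+1 t.
Proof.
move=> sAZ sBZ dAB cAB /existsP[f /and3P[/injectiveP fI /forallP fA /forallP fE]] tB.
have [B' sB' cB'] := subset_of_card tB.
have [h hI hB] : exists2 h : 'I_t -> V, injective h & forall a, h a \in B.
  exists (fun a => enum_val (cast_ord (esym cB') a)).
    by move=> a b /enum_val_inj/cast_ord_inj.
  by move=> a; apply: (subsetP sB'); apply: enum_valP.
have nAB a x : x \in A -> h a <> x.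
  by move=> xA hx; move/disjointFr: dAB => /(_ x xA); rewrite -hx hB.
(* The last part is sent into [B]; the others follow [f]. *)
pose g (p : 'I_k.+1 * 'I_t) :=
  if unlift ord_max p.1 is Some i then f (i, p.2) else h p.2.
apply/existsP; exists (finfun g); apply/and3P; split.
- apply/injectiveP => -[i a] [j b]; rewrite !ffunE /g /=.
  case: unliftP => [i'|] ->; case: unliftP => [j'|] -> //.
  + by move/fI => [-> ->].
  + by move=> Hf; case: (@nAB b (f (i', a))).
  + by move=> Hf; case: (@nAB a (f (j', b))).
  + by move/hI ->.
- apply/forallP => -[i a]; rewrite ffunE /g /=.
  by case: unliftP => [i'|] _; [apply: (subsetP sAZ) | apply: (subsetP sBZ)].
apply/forallP => i; apply/forallP => j; apply/forallP => a; apply/forallP => b.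
apply/implyP; rewrite !ffunE /g /=.
case: unliftP => [i'|] ->; case: unliftP => [j'|] -> ij.
- move/forallP: (fE i') => /(_ j')/forallP/(_ a)/forallP/(_ b)/implyP; apply.
  by apply: contraNneq ij => ->.
- by case: (cAB (f (i', a)) (h b)).
- by case: (cAB (f (j', b)) (h a)).
- by rewrite eqxx in ij.
Qed.

Lemma containsK_in0 Z t : containsK_in E Z 0 t.
Proof.
have f : 'I_0 * 'I_t -> V by case=> -[].
apply/existsP; exists (finfun f); apply/and3P; split.
- by apply/injectiveP => -[[]].
- by apply/forallP => -[[]].
- by apply/forallP => -[].
Qed.

Lemma containsK_inS Z Z' k t :
  Z \subset Z' -> containsK_in E Z k t -> containsK_in E Z' k t.
Proof.
move=> sZ /existsP[f /and3P[fI /forallP fZ fE]].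
apply/existsP; exists f; apply/and3P; split=> //.
by apply/forallP => x; apply: (subsetP sZ).
Qed.

Lemma containsK_in_parts Z t : containsK_in E Z 2 t ->
  exists A B, [/\ A \subset Z, B \subset Z & K2_parts E A B t].
Proof.
move=> /existsP[f /and3P[/injectiveP fI /forallP fZ /forallP fE]].
pose P i := [set f (i, a) | a : 'I_t].
have PZ i : P i \subset Z by apply/subsetP => _ /imsetP[a _ ->].
have cP i : #|P i| = t.
  by rewrite card_imset ?card_ord // => a b /fI[].
exists (P ord0), (P ord_max); split=> //; split; last split=> //; last split=> //.
  rewrite disjoint_subset; apply/subsetP => _ /imsetP[a _ ->].
  by apply/negP => /imsetP[b _ /fI[]].
move=> _ _ /imsetP[a _ ->] /imsetP[b _ ->].
by move/forallP: (fE ord0) => /(_ ord_max)/forallP/(_ a)/forallP/(_ b)/implyP; apply.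
Qed.

Hypotheses (symE : symmetric E) (irrE : irreflexive E).

Lemma complete_disjoint (A B : {set V}) :
  (forall x y, x \in A -> y \in B -> E x y) -> [disjoint A & B].
Proof.
move=> cAB; rewrite disjoint_subset; apply/subsetP => x xA.
by apply/negP => xB; have := cAB x x xA xB; rewrite irrE.
Qed.

Lemma containsK_in2 Z A B t :
  A \subset Z -> B \subset Z -> (forall x y, x \in A -> y \in B -> E x y) ->
  t <= #|A| -> t <= #|B| -> containsK_in E Z 2 t.
Proof.
move=> sA sB cAB tA tB.
apply: (@containsK_in_add Z A B) => //; first exact: complete_disjoint.
  by move=> x y xA yB; rewrite [E y x]symE; have := cAB x y xA yB.
apply: (@containsK_in_add A set0 A); rewrite ?sub0set //.
- by rewrite disjoint_subset; apply/subsetP => x; rewrite inE.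
- by move=> x y; rewrite inE.
- exact: containsK_in0.
Qed.

(** * Branching vertices and their killers *)

Definition cnbr x := [set y | (y == x) || E x y].

(** Recursing in [S :\: cnbr u] keeps all descendants below the children non-adjacent to [u]. The
    root [u] need not lie in [S]. *)
Fixpoint branching (h z : nat) (S : {set V}) (u : V) : bool :=
  if h is h'.+1
  then z <= #|[set c in S | E u c && branching h' z (S :\: cnbr u) c]|
  else true.

Lemma branchingE h z S u : branching h.+1 z S u =
  (z <= #|[set c in S | E u c && branching h z (S :\: cnbr u) c]|).
Proof. by []. Qed.

Lemma branching_mono h z z' S S' u :
  z' <= z -> S \subset S' -> branching h z S u -> branching h z' S' u.
Proof.
move=> zz; elim: h S S' u => //= h IHh S S' u sS zc.
apply: leq_trans (leq_trans zz zc) (subset_leq_card _).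
apply/subsetP => c; rewrite !inE => /and3P[cS -> br] /=.
by rewrite (subsetP sS) //= (IHh (S :\: cnbr u)) // setSD.
Qed.

Lemma branching_height h z S u : branching h.+1 z S u -> branching h z S u.
Proof.
elim: h S u => // h IHh S u; rewrite (branchingE h.+1) (branchingE h) => zc.
apply: leq_trans zc (subset_leq_card _).
by apply/subsetP => c; rewrite !inE => /and3P[-> -> /IHh ->].
Qed.

(** The recurrence produced by the double count in [card_killers]. *)
Fixpoint kbound (t h : nat) : nat :=
  if h is h'.+1 then 4 * t * (kbound t h').+2 else 0.

(* Killers of [u] either kill many children deeper down, which by induction
   happens rarely, or are adjacent to almost all children; [t] of the latter kind
   would give a [K_2(t)]. *)
Lemma card_killers t h z S Z u :
  0 < t -> 0 < z -> S \subset Z -> ~~ containsK_in E Z 2 t ->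
  branching h (4 * t * z) S u ->
  #|[set x in Z | ~~ branching h z (S :\: cnbr x) u]| <= kbound t h.
Proof.
move=> t0 z0 + nK; elim: h S u => [|h IHh] S u sSZ.
  move=> _; rewrite leqn0 cards_eq0; apply/eqP/setP => x.
  by rewrite !inE andbF.
rewrite branchingE.
set C := [set c in S | _] => cC.
set X := [set x in Z | _].
(* [n x] counts the children that [x] misses; [P x c] says that [x] equals [c] or kills the tree at
   [c]. *)
pose n x := #|[set c in C | ~~ E x c]|.
pose P x c := (c == x) || ~~ branching h z ((S :\: cnbr u) :\: cnbr x) c.
have sCZ : C \subset Z.
  by apply/subsetP => c; rewrite inE => /andP[/(subsetP sSZ)].
have Pc c : c \in C -> \sum_(x in X) P x c <= (kbound t h).+1.
  rewrite inE => /and3P[cS _ br].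
  rewrite -big_mkcondr /= sum1_card.
  have sub : [pred x in X | P x c] \subset
      c |: [set x in Z | ~~ branching h z ((S :\: cnbr u) :\: cnbr x) c].
    apply/subsetP => x; rewrite !inE /P eq_sym => /andP[/andP[-> _] /=].
    by case: eqP.
  apply: leq_trans (subset_leq_card sub) _.
  rewrite cardsU1 -add1n; apply: leq_add; first by case: (_ \notin _).
  by apply: IHh => //; apply: subset_trans sSZ; apply: subsetDl.
(* Missed children for which [P x c] fails are still children of [u] after [cnbr x] is deleted, so a
   killer [x] has fewer than [z] of them. *)
have nx x : x \in X -> n x <= z + \sum_(c in C) P x c.
  rewrite inE branchingE -ltnNge => /andP[_ small].
  rewrite -big_mkcondr /= sum1_card.
  apply: leq_trans (leq_add (ltnW small) (leqnn _)).
  rewrite -(cardsE [pred c in C | P x c]); apply: leq_trans (leq_card_setU _ _).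
  apply: subset_leq_card; apply/subsetP => c; rewrite !inE.
  case/andP=> /and3P[cS uc br] xc; rewrite cS uc br /= /P (negbTE xc) orbF.
  case: eqP => //= _; rewrite setDDl setUC -setDDl.
  by case: branching.
(* Killers missing at most a fraction [1 / 2t] of the children. Any [t] of them together miss at
   most half of [C], and the other half has at least [t] vertices. *)
pose L := [set x in X | 2 * t * n x <= #|C|].
have Lt : #|L| < t.
  rewrite ltnNge; apply: contra nK => tL.
  have [L' sL' cL'] := subset_of_card tL.
  pose Y := [set c in C | [forall x in L', E x c]].
  have CY : #|C| <= #|Y| + \sum_(x in L') n x.
    have sub : C \subset Y :|: \bigcup_(x in L') [set c in C | ~~ E x c].
      apply/subsetP => c cC'; rewrite in_setU inE cC' /=.
      case: forallP => //= H; apply/bigcupP.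
      have /existsP[x] : [exists x, ~~ ((x \in L') ==> E x c)].
        by rewrite -negb_forall; apply/forallP.
      by rewrite negb_imply => /andP[xL xc]; exists x => //; rewrite inE cC'.
    apply: leq_trans (subset_leq_card sub) _.
    by apply: leq_trans (leq_card_setU _ _) _; rewrite leq_add2l leq_card_bigcup.
  have sum2 : 2 * t * \sum_(x in L') n x <= t * #|C|.
    rewrite big_distrr /= -[t in t * #|C|]cL' -sum_nat_const.
    by apply: leq_sum => x /(subsetP sL'); rewrite inE => /andP[].
  have Yt : t <= #|Y| by nia.
  apply: (@containsK_in2 Z L' Y t) => //; last by rewrite cL'.
  - by apply/subsetP => x /(subsetP sL'); rewrite !inE => /andP[/andP[]].
  - apply: subset_trans sCZ; apply/subsetP => c; by rewrite inE => /andP[].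
  - by move=> x y xL; rewrite inE => /andP[_ /forallP/(_ x)/implyP]; apply.
have up : \sum_(x in X) n x <= #|X| * z + #|C| * (kbound t h).+1.
  apply: (@leq_trans (\sum_(x in X) (z + \sum_(c in C) P x c))).
    by apply: leq_sum.
  rewrite big_split /= sum_nat_const leq_add2l.
  by rewrite exchange_big -sum_nat_const; apply: leq_sum.
(* Each killer outside [L] misses more than [#|C| / 2t] children. *)
have low : (#|X| - #|L|) * #|C| <= 2 * t * \sum_(x in X) n x.
  have sLX : L \subset X by apply/subsetP => x; rewrite inE => /andP[].
  have -> : #|X| - #|L| = #|X :\: L| by rewrite cardsD (setIidPr sLX).
  rewrite -sum_nat_const big_distrr /=.
  rewrite [X in _ <= X](big_setID (X :\: L)) /= (setIidPr (subsetDl X L)).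
  apply: leq_trans (leq_addr _ _); apply: leq_sum => x.
  by rewrite !in_setD inE => /andP[nL xX]; move: nL; rewrite xX -ltnNge => /ltnW.
have C0 : 0 < #|C| by apply: leq_trans cC; rewrite !muln_gt0 t0.
rewrite /=; set K := kbound t h in up *.
(* Since [4 * t * z <= #|C|], the term [2 * t * z * #|X|] of the upper bound is at most half of
   [#|X| * #|C|] and is absorbed on the left. *)
suff : #|X| * #|C| <= 4 * t * K.+2 * #|C| by rewrite leq_pmul2r.
have H1 : 4 * t * z * #|X| <= #|C| * #|X| by rewrite leq_mul2r cC orbT.
have H2 : #|L| * #|C| <= t * #|C| by rewrite leq_mul2r ltnW ?orbT.
have H3 : 2 * t * \sum_(x in X) n x <= 2 * t * (#|X| * z + #|C| * K.+1).
  by rewrite leq_mul2l up orbT.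
rewrite mulnBl in low.
set XC := #|X| * #|C| in low *; nia.
Qed.


(** * Degeneracy and colouring *)

Definition colorable_on S k : Prop := exists c : V -> nat,
  {in S, forall x, c x < k} /\ {in S &, forall x y, E x y -> c x <> c y}.

Lemma colorable_onU A B k l :
  colorable_on A k -> colorable_on B l -> colorable_on (A :|: B) (k + l).
Proof.
move=> [c [ck cE]] [e [el eE]].
exists (fun x => if x \in A then c x else k + e x).
have inB x : x \in A :|: B -> x \notin A -> x \in B.
  by rewrite inE => /orP[->|].
split=> [x xAB|x y xAB yAB xy] /=.
  case: ifPn => [/ck|/(inB _ xAB)/el]; lia.
case: ifPn => xA; case: ifPn => yA.
- exact: cE.
- by have := ck x xA; lia.
- by have := ck y yA; lia.
- by have := eE x y (inB x xAB xA) (inB y yAB yA) xy; lia.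
Qed.

Lemma colorable_on_sub A B k l :
  A \subset B -> k <= l -> colorable_on B k -> colorable_on A l.
Proof.
move=> /subsetP sAB kl [c [ck cE]]; exists c; split=> [x /sAB/ck|x y /sAB xB /sAB].
  by move/leq_trans; apply.
exact: cE.
Qed.

(** Greedy colouring: the vertex of low degree is coloured last, with a colour its neighbours leave
    free. *)
Lemma colorable_on_degenerate S k :
  (forall A, A \subset S -> A != set0 ->
     exists2 x, x \in A & #|[set y in A | E x y]| < k) ->
  colorable_on S k.
Proof.
have [n] := ubnP #|S|; elim: n S => // n IHn S Sn deg.
have [->|S0] := eqVneq S set0.
  by exists (fun=> 0); split=> x => [|y]; rewrite inE.
have [x xS xk] := deg S (subxx S) S0.
have [||c [ck cE]] := IHn (S :\ x).
- by move: Sn; rewrite (cardsD1 x S) xS.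
- by move=> A sA; apply: deg; apply: subset_trans sA (subD1set _ _).
pose s := [seq c y | y in [set y in S | E x y]].
have [a ak as_] : exists2 a, a < k & a \notin s.
  have /allPn[a] : ~~ all (mem s) (iota 0 k).
    apply/negP => /allP ks; have := uniq_leq_size (iota_uniq 0 k) ks.
    by rewrite size_iota size_image leqNgt xk.
  by rewrite mem_iota /= => ak; exists a.
have cN y : y \in S -> E x y -> c y <> a.
  move=> yS xy; apply/eqP; apply: contraNneq as_ => <-.
  by apply: image_f; rewrite inE yS.
exists (fun y => if y == x then a else c y); split=> [y yS|y z yS zS yz] /=.
  by case: eqP => // yx; apply: ck; rewrite !inE yS andbT; apply/eqP.
case: eqP yz => [->|/eqP yx] yz; case: eqP yz => [->|/eqP zx] yz.
- by rewrite irrE in yz.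
- exact/nesym/cN.
- by apply: cN => //; rewrite symE.
- by apply: cE; rewrite // !inE ?yx ?zx.
Qed.

Fixpoint cbound (t h z : nat) : nat :=
  if h is h'.+1 then cbound t h' (4 * t * z) + (z + kbound t h') else 0.

(** Vertices failing at height [h.+1] either fail already at height [h] with spread [4 * t * z], and
    are coloured by induction, or lie in [Q], where [card_killers] applies at height [h]. *)
Lemma colorable_on_not_branching t h z Z :
  0 < t -> 0 < z -> ~~ containsK_in E Z 2 t ->
  colorable_on [set u in Z | ~~ branching h z Z u] (cbound t h z).
Proof.
move=> t0 + nK; elim: h z => [|h IHh] z z0.
  by exists (fun=> 0); split=> x => [|y]; rewrite inE andbF.
have z40 : 0 < 4 * t * z by rewrite !muln_gt0 t0.
pose Q := [set u in Z | branching h (4 * t * z) Z u && ~~ branching h.+1 z Z u].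
have cQ : colorable_on Q (z + kbound t h).
  apply: colorable_on_degenerate => A sAQ A0.
  (* An arc [u -> c] inside [A] is charged to [u] if the tree at [c] survives the
     deletion of [cnbr u], and to [c] otherwise. *)
  have dout u : u \in A ->
      #|[set c in A | E u c && branching h z (Z :\: cnbr u) c]| < z.
    move=> /(subsetP sAQ); rewrite inE branchingE -ltnNge => /and3P[_ _].
    apply: leq_ltn_trans; apply/subset_leq_card/subsetP => c.
    rewrite !inE => /andP[/(subsetP sAQ) cQ ->]; move: cQ.
    by rewrite inE => /and3P[->].
  have din c : c \in A ->
      #|[set u in A | E u c && ~~ branching h z (Z :\: cnbr u) c]| <= kbound t h.
    move=> /(subsetP sAQ); rewrite inE => /and3P[_ br _].
    apply: leq_trans (card_killers t0 z0 (subxx Z) nK br).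
    apply/subset_leq_card/subsetP => u.
    rewrite !inE => /and3P[/(subsetP sAQ) uQ _ ->]; move: uQ.
    by rewrite inE => /and3P[->].
  apply/exists_inP; apply: contraT; rewrite negb_exists_in => /forall_inP big.
  (* If all degrees in [A] were at least [z + kbound t h], there would be more arcs than the [z.-1]
     and [kbound t h] charged to each vertex allow. *)
  suff : \sum_(u in A) (z + kbound t h) <= \sum_(u in A) (z.-1 + kbound t h).
    by rewrite !sum_nat_const leq_pmul2l ?card_gt0 //; lia.
  apply: (@leq_trans (\sum_(u in A) #|[set y in A | E u y]|)).
    by apply: leq_sum => u /big; rewrite -leqNgt.
  have cardE (P : pred V) : #|[set c in A | P c]| = \sum_(c in A) P c.
    by rewrite -big_mkcondr -sum1_card; apply: eq_bigl => c; rewrite inE.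
  rewrite big_split /=.
  apply: (@leq_trans (\sum_(u in A)
       #|[set c in A | E u c && branching h z (Z :\: cnbr u) c]| +
     \sum_(c in A)
       #|[set u in A | E u c && ~~ branching h z (Z :\: cnbr u) c]|)).
    under [X in _ + X]eq_bigr => c _ do rewrite cardE //.
    rewrite [X in _ + X]exchange_big -big_split; apply: leq_sum => u _ /=.
    rewrite !cardE // -big_split; apply: leq_sum => c _ /=.
    by case: (E u c) => //=; case: branching.
  by apply: leq_add; apply: leq_sum => u uA; [have := dout u uA; lia | apply: din].
apply: colorable_on_sub (colorable_onU (IHh _ z40) cQ); last by [].
apply/subsetP => u; rewrite !in_setU !in_set => /andP[-> ->] /=.
by rewrite andbT orNb.
Qed.

Lemma chi_colorable_on k : colorable_on [set: V] k -> chi E <= k.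
Proof.
move=> [c [ck cE]]; rewrite /chi; have [kV|Vk] := leqP k #|V|.
  have kV1 : k < #|V|.+1 by [].
  apply: (@bigminn_le _ _ _ _ _ (Ordinal kV1)); first exact: mem_index_enum.
  have ck' x : c x < k by apply: ck; rewrite inE.
  apply/existsP; exists [ffun x => Ordinal (ck' x)].
  apply/forallP => x; apply/forallP => y; apply/implyP => xy; rewrite !ffunE.
  by apply/eqP => -[]; apply: cE; rewrite ?inE.
(* The minimum defining [chi] starts from the default value [#|V|]. *)
apply: leq_trans (ltnW Vk); elim/big_rec: _ => // i x _.
by apply: leq_trans; apply: geq_minr.
Qed.

End Graph.

(** * Growing subtrees and embedding trees *)

Section TreeEmbedding.
Variables (W : finType) (ET : rel W).
Hypothesis treeET : is_tree ET.

Definition arcs (S : {set W}) : nat := \sum_(x in S) \sum_(y in S) ET x y.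

Lemma arcsU1 (S : {set W}) w : w \notin S ->
  arcs (w |: S) = arcs S + 2 * #|[set y in S | ET w y]|.
Proof.
have [[symT irrT] _] := treeET => wS.
have wN : #|[set y in S | ET w y]| = \sum_(y in S) ET w y.
  by rewrite -big_mkcondr -sum1_card; apply: eq_bigl => y; rewrite inE.
rewrite /arcs big_setU1 // big_setU1 // irrT wN.
under [X in _ + X = _]eq_bigr => x _ do rewrite big_setU1 // symT.
by rewrite big_split /=; lia.
Qed.

Lemma exists_boundary_edge (S : {set W}) : S != set0 -> S != setT ->
  exists z w, [/\ z \in S, w \notin S & ET z w].
Proof.
have [[symT irrT] [_ [conT _]]] := treeET => /set0Pn[x xS] ST.
have /subsetPn[y _ yS] : ~~ (setT \subset S) by rewrite subTset.
have [/existsP[z /existsP[w /and3P[zS wS zw]]]|no] :=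
  boolP [exists z, exists w, [&& z \in S, w \notin S & ET z w]].
  by exists z, w.
have clS : closed ET S.
  move=> a b ab; apply/idP/idP => [aS|bS]; apply: contraNT no => H.
    by apply/existsP; exists a; apply/existsP; exists b; rewrite aS H.
  by apply/existsP; exists b; apply/existsP; exists a; rewrite bS H symT.
by have := closed_connect clS (conT x y); rewrite xS (negbTE yS).
Qed.

(** By connectedness [S] grows to all of [W] one vertex at a time, each step gaining at least two
    arcs. *)
Lemma arcs_grow (S : {set W}) : S != set0 ->
  arcs S + 2 * (#|W| - #|S|) <= 2 * (#|W| - 1).
Proof.
have [n] := ubnP (#|W| - #|S|); elim: n S => // n IHn S Sn S0.
have [->|ST] := eqVneq S setT.
  rewrite cardsT subnn muln0 addn0; have [_ [_ [_ <-]]] := treeET.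
  rewrite /arcs pair_big /= -sum1_card [X in _ <= X]big_mkcond /=.
  rewrite big_mkcond /=; apply: leq_sum => p _; rewrite !inE.
  by case: ET.
have [z [w [zS wS zw]]] := exists_boundary_edge S0 ST.
have cS : #|w |: S| = #|S|.+1 by rewrite cardsU1 wS.
have Sle : #|S|.+1 <= #|W| by rewrite -cS max_card.
have [[symT _] _] := treeET.
have N0 : 0 < #|[set y in S | ET w y]|.
  by apply/card_gt0P; exists z; rewrite inE zS symT.
have U0 : w |: S != set0 by apply/set0Pn; exists w; rewrite setU11.
by have := IHn (w |: S); rewrite cS arcsU1 // => /(_ _ U0); lia.
Qed.

(** Acyclicity by counting: two neighbours in [S] would give [w |: S] more arcs than [arcs_grow]
    permits. *)
Lemma boundary_edge_unique (S : {set W}) z w y :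
  2 * (#|S| - 1) <= arcs S -> z \in S -> w \notin S -> ET w z ->
  y \in S -> ET w y -> y = z.
Proof.
move=> aS zS wS wz yS wy; apply/eqP; apply: contraT => yz.
have : 1 < #|[set y in S | ET w y]|.
  by apply/card_gt1P; exists y, z; rewrite !inE yS zS wy wz.
have U0 : w |: S != set0 by apply/set0Pn; exists w; rewrite setU11.
have S0 : 0 < #|S| by apply/card_gt0P; exists z.
have cS : #|w |: S| = #|S|.+1 by rewrite cardsU1 wS.
have := max_card (w |: S).
by have := arcs_grow U0; rewrite arcsU1 // cS; lia.
Qed.

(** The factor [4 * t] pays for one deletion in [card_killers]; the summand [#|W| * kbound t m]
    ensures a child that kills none of the trees in use. *)
Fixpoint spread (t m : nat) : nat :=
  if m is m'.+1 then 4 * t * (spread t m' + #|W| * kbound t m).+1 else 1.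

Section Host.
Variables (V : finType) (E : rel V).
Hypotheses (symE : symmetric E) (irrE : irreflexive E).

(* The region in which the tree reserved at [h x] may live. *)
Definition free_for (Z : {set V}) (S : {set W}) (h : W -> V) (x : W) : {set V} :=
  [set v in Z | [forall y in S, (y != x) ==> (v \notin cnbr E (h y))]].

Lemma free_forP (Z : {set V}) (S : {set W}) (h : W -> V) (x : W) v :
  reflect (v \in Z /\ (forall y, y \in S -> y != x -> v \notin cnbr E (h y)))
          (v \in free_for Z S h x).
Proof.
rewrite inE; apply: (iffP andP) => -[-> H]; split=> //.
  by move=> y yS yx; move/forall_inP: H => /(_ y yS)/implyP; apply.
by apply/forall_inP => y yS; apply/implyP; apply: H.
Qed.

(** The invariant of the embedding: while [m] vertices remain to be placed, each image roots a
    reserve of height [m] that avoids the closed neighbourhoods of the other images. *)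
Lemma embed_tree_from t (Z : {set V}) m (S : {set W}) (h : W -> V) :
  0 < t -> ~~ containsK_in E Z 2 t ->
  #|S| + m = #|W| -> S != set0 -> 2 * (#|S| - 1) <= arcs S ->
  {in S &, injective h} ->
  {in S &, forall x y, E (h x) (h y) = ET x y} ->
  {in S, forall x, branching E m (spread t m) (free_for Z S h x) (h x)} ->
  ~ T_free ET E.
Proof.
move=> t0 nK; elim: m S h => [|m IHm] S h Sm S0 aS hI hE br.
  have ST x : x \in S.
    have : S == setT by rewrite eqEcard subsetT cardsT; lia.
    by move/eqP ->; rewrite inE.
  by apply; exists h; split=> [x y|x y]; [apply: hI | apply: hE].
have ST : S != setT by apply: contra_eq_neq Sm => ->; rewrite cardsT; lia.
have [z [w [zS wS zw]]] := exists_boundary_edge S0 ST.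
have [[symT irrT] _] := treeET.
(* The new vertex [w] is a leaf attached at [z]. *)
have wNz y : y \in S -> ET w y = (y == z).
  move=> yS; apply/idP/eqP => [wy|->]; last by rewrite symT.
  by apply: (boundary_edge_unique aS zS wS); rewrite // symT.
move: br; rewrite -[spread t m.+1]/(4 * t * (spread t m + #|W| * kbound t m.+1).+1).
set q := (_ + _).+1 => br.
have freeZ x : free_for Z S h x \subset Z by apply/subsetP => v /free_forP[].
set C := [set c in free_for Z S h z | E (h z) c &&
  branching E m (4 * t * q) (free_for Z S h z :\: cnbr E (h z)) c].
have Cq : 4 * t * q <= #|C| by have := br z zS; rewrite branchingE.
pose kill x := [set c in Z | ~~ branching E m.+1 q (free_for Z S h x :\: cnbr E c) (h x)].
have killK x : x \in S -> #|kill x| <= kbound t m.+1.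
  by move=> xS; apply: (card_killers symE irrE) => //; apply: br.
(* The killers of all reserves together are fewer than the children of [h z]. *)
have /subsetPn[c cC cK] : ~~ (C \subset \bigcup_(x in S) kill x).
  apply/negP => /subset_leq_card; apply/negP; rewrite -ltnNge.
  apply: (@leq_ltn_trans (#|S| * kbound t m.+1)).
    by apply: leq_trans (leq_card_bigcup _ _) _; rewrite -sum_nat_const leq_sum.
  apply: leq_trans Cq.
  have : #|S| * kbound t m.+1 <= #|W| * kbound t m.+1 by rewrite leq_mul2r max_card orbT.
  by rewrite /q; nia.
move: cC; rewrite inE => /and3P[/free_forP[cZ cfree] zc brc].
have cnE y : y \in S -> y != z -> E (h y) c = false.
  by move=> yS yz; have := cfree y yS yz; rewrite inE negb_or => /andP[_ /negbTE].
have cne y : y \in S -> h y <> c.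
  move=> yS hy; have [yz|yz] := eqVneq y z.
    by rewrite -hy yz irrE in zc.
  by have := cfree y yS yz; rewrite inE hy eqxx.
pose h' y := if y == w then c else h y.
have h'w : h' w = c by rewrite /h' eqxx.
have h'S y : y \in S -> h' y = h y.
  by rewrite /h'; case: eqP => // ->; rewrite (negbTE wS).
apply: (IHm (w |: S) h').
- by rewrite cardsU1 wS; lia.
- by apply/set0Pn; exists w; rewrite setU11.
- rewrite arcsU1 // cardsU1 wS.
  have : 0 < #|[set y in S | ET w y]|.
    by apply/card_gt0P; exists z; rewrite inE zS symT.
  have : 0 < #|S| by rewrite card_gt0.
  by lia.
- move=> x y /setU1P[->|xS] /setU1P[->|yS] //; rewrite ?h'w ?h'S //.
  + by move/esym/(cne _ yS).
  + by move/(cne _ xS).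
  + exact: hI.
- have cN y : y \in S -> E c (h y) = ET w y.
    move=> yS; rewrite symE wNz //; case: eqVneq => [->|] //; exact: cnE.
  move=> x y /setU1P[->|xS] /setU1P[->|yS]; rewrite ?h'w ?h'S ?irrE ?irrT ?cN //.
  + by rewrite symE symT cN.
  + exact: hE.
(* The reserve of [c] is its own subtree, which already avoids [cnbr E (h z)]. *)
move=> x /setU1P[->|xS].
  rewrite h'w; apply: branching_mono brc; first by rewrite /q; nia.
  apply/subsetP => v; rewrite inE => /andP[vz /free_forP[vZ vS]].
  apply/free_forP; split=> // y /setU1P[->|yS]; first by rewrite eqxx.
  by rewrite h'S // => _; have [->|] := eqVneq y z; last exact: vS.
(* As [c] kills nothing, the old reserves keep spread [q]; one level of their height is then given
   up. *)
have xkill : branching E m.+1 q (free_for Z S h x :\: cnbr E c) (h x).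
  apply: contraNT cK => nb; apply/bigcupP; exists x => //.
  by rewrite inE cZ.
rewrite h'S //; apply: branching_mono (branching_height xkill).
  by rewrite /q; lia.
apply/subsetP => v; rewrite inE => /andP[vc /free_forP[vZ vS]].
apply/free_forP; split=> // y /setU1P[->|yS] yx; first by rewrite h'w.
by rewrite h'S //; apply: vS.
Qed.

(** A single vertex branching at height [#|W|.-1] would start an embedding of the whole tree, so no
    vertex of [Z] is branching. *)
Lemma colorable_on_T_free t (Z : {set V}) : 0 < t -> ~~ containsK_in E Z 2 t ->
  T_free ET E -> colorable_on E Z (cbound t #|W|.-1 (spread t #|W|.-1)).
Proof.
move=> t0 nK Tf; have [[_ irrT] [W0 _]] := treeET; have /card_gt0P[r _] := W0.
have sp0 : 0 < spread t #|W|.-1 by case: _.-1 => //= m; rewrite !muln_gt0 t0.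
apply: colorable_on_sub (colorable_on_not_branching symE irrE #|W|.-1 t0 sp0 nK) => //.
apply/subsetP => u uZ; rewrite inE uZ /=; apply/negP => br; move: Tf.
apply: (@embed_tree_from t Z #|W|.-1 [set r] (fun=> u)) => //.
- by rewrite cards1; lia.
- by apply/set0Pn; exists r; rewrite set11.
- by rewrite cards1.
- by move=> x y /set1P-> /set1P->.
- by move=> x y /set1P-> /set1P->; rewrite irrE irrT.
move=> x /set1P->; apply: branching_mono br => //.
by apply/subsetP => v vZ; apply/free_forP; split=> // y /set1P->; rewrite eqxx.
Qed.

End Host.
End TreeEmbedding.

(** * Polynomial bounds *)

Definition poly_bounded (g : nat -> nat) : Prop :=
  exists a b, forall t, 0 < t -> g t <= a * t ^ b.

Lemma poly_bounded_const n : poly_bounded (fun=> n).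
Proof. by exists n, 0 => t _; rewrite expn0 muln1. Qed.

Lemma poly_bounded_id : poly_bounded id.
Proof. by exists 1, 1 => t _; rewrite expn1 mul1n. Qed.

Lemma poly_boundedD f g :
  poly_bounded f -> poly_bounded g -> poly_bounded (fun t => f t + g t).
Proof.
move=> [a [b fab]] [c [d gcd]]; exists (a + c), (b + d) => t t0.
rewrite mulnDl; apply: leq_add.
  apply: leq_trans (fab t t0) _; rewrite leq_mul2l expnD leq_pmulr ?orbT //.
  by rewrite expn_gt0 t0.
apply: leq_trans (gcd t t0) _; rewrite leq_mul2l expnD leq_pmull ?orbT //.
by rewrite expn_gt0 t0.
Qed.

Lemma poly_boundedM f g :
  poly_bounded f -> poly_bounded g -> poly_bounded (fun t => f t * g t).
Proof.
move=> [a [b fab]] [c [d gcd]]; exists (a * c), (b + d) => t t0.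
by rewrite expnD mulnACA leq_mul ?fab ?gcd.
Qed.

Lemma poly_boundedX f n :
  poly_bounded f -> poly_bounded (fun t => f t ^ n).
Proof.
move=> fP; elim: n => [|n IHn]; first exact: poly_bounded_const.
have [a [b H]] := poly_boundedM fP IHn; exists a, b => t t0.
by rewrite expnS H.
Qed.

Lemma poly_bounded_kbound h : poly_bounded (kbound^~ h).
Proof.
elim: h => [|h IHh] /=; first exact: poly_bounded_const.
apply: poly_boundedM.
  exact: poly_boundedM (poly_bounded_const 4) poly_bounded_id.
have [a [b H]] := poly_boundedD IHh (poly_bounded_const 2).
by exists a, b => t t0; rewrite -addn2 H.
Qed.

Lemma poly_bounded_cbound h g :
  poly_bounded g -> poly_bounded (fun t => cbound t h (g t)).
Proof.
elim: h g => [|h IHh] g gP /=; first exact: poly_bounded_const.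
apply: poly_boundedD; last exact: poly_boundedD gP (poly_bounded_kbound h).
apply: (IHh (fun t => 4 * t * g t)); apply: poly_boundedM gP.
exact: poly_boundedM (poly_bounded_const 4) poly_bounded_id.
Qed.

Lemma poly_bounded_spread (W : finType) m : poly_bounded (fun t => spread W t m).
Proof.
elim: m => [|m IHm]; first exact: poly_bounded_const.
apply: (@poly_boundedM (fun t => 4 * t)).
  exact: poly_boundedM (poly_bounded_const 4) poly_bounded_id.
have [a [b H]] := poly_boundedD (poly_boundedD IHm
  (poly_boundedM (poly_bounded_const #|W|) (poly_bounded_kbound m.+1)))
  (poly_bounded_const 1).
by exists a, b => t t0; rewrite -addn1 H.
Qed.

Lemma poly_bounded_beta (W : finType) (ET : rel W) : poly_bounded (beta ET).
Proof.
apply: poly_boundedD (poly_bounded_const 1); apply: poly_boundedX.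
exact: poly_boundedM (poly_bounded_const _) poly_bounded_id.
Qed.

Lemma poly_colorable_T_free (W : finType) (ET : rel W) : is_tree ET ->
  exists a b, forall (V : finType) (E : rel V), simple_graph E -> T_free ET E ->
  forall t (Z : {set V}), 0 < t -> ~~ containsK_in E Z 2 t ->
  colorable_on E Z (a * t ^ b).
Proof.
move=> treeET.
have [a [b ab]] := poly_bounded_cbound #|W|.-1 (poly_bounded_spread W #|W|.-1).
exists a, b => V E [symE irrE] Tf t Z t0 nK.
by apply: colorable_on_sub (colorable_on_T_free treeET symE irrE t0 nK Tf) => //; apply: ab.
Qed.

(** * From [K_2(N)] to [K_d(t)] *)

Fixpoint nbound (a b beta t d : nat) : nat :=
  if d is d'.+1 then beta * (a * nbound a b beta t d' ^ b) + nbound a b beta t d'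
  else t + beta.

Lemma nbound_ge a b beta t d : t + beta <= nbound a b beta t d.
Proof. by elim: d => //= d IHd; apply: leq_trans IHd (leq_addl _ _). Qed.

Lemma poly_bounded_nbound a b d beta :
  poly_bounded beta -> poly_bounded (fun t => nbound a b (beta t) t d).
Proof.
move=> bP; elim: d => [|d IHd] /=; first exact: poly_boundedD poly_bounded_id bP.
apply: poly_boundedD (IHd); apply: poly_boundedM => //.
exact: poly_boundedM (poly_bounded_const a) (poly_boundedX b IHd).
Qed.

(** If [Z] has a [K_2(N)], recursion in one part gives all parts but one, and the other side
    supplies the last. Otherwise [a * N ^ b] colours suffice, and by pigeonhole some colour class
    contains an independent set of size [beta]. *)
Lemma containsK_in_large (V : finType) (E : rel V) a b beta t d (Z : {set V}) :
  simple_graph E -> 0 < t ->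
  (forall s (S : {set V}), 0 < s -> ~~ containsK_in E S 2 s ->
     colorable_on E S (a * s ^ b)) ->
  (forall S : {set V}, S \subset Z -> #|S| = beta ->
     exists x y, [/\ x \in S, y \in S & E x y]) ->
  nbound a b beta t d <= #|Z| -> containsK_in E Z d t.
Proof.
move=> [symE irrE] t0 col; elim: d Z => [|d IHd] Z nind /= NZ.
  exact: containsK_in0.
set N := nbound a b beta t d in IHd NZ.
have N0 : 0 < N by have := nbound_ge a b beta t d; rewrite -/N; lia.
have [/containsK_in_parts[A [B [sA sB [dAB [cA [cB cAB]]]]]]|nK] :=
  boolP (containsK_in E Z 2 N).
  apply: (containsK_in_add sA sB dAB).
  - by move=> x y xA yB; rewrite [E y x]symE; have := cAB x y xA yB.
  - by apply: IHd; rewrite ?cA // => S sS; apply: nind; apply: subset_trans sA.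
  - by rewrite cB; have := nbound_ge a b beta t d; rewrite -/N; lia.
have [c [ck cE]] := col N Z N0 nK.
set k := a * N ^ b in ck NZ.
pose cl (i : 'I_k) := [set x in Z | c x == i].
have [i|small] := pickP (fun i => beta <= #|cl i|).
  move=> /subset_of_card[S sS cS].
  have [|x [y [xS yS xy]]] := nind S _ cS.
    by apply: subset_trans sS _; apply/subsetP => x; rewrite inE => /andP[].
  have := subsetP sS x xS; have := subsetP sS y yS.
  rewrite !inE => /andP[yZ /eqP cy] /andP[xZ /eqP cx].
  by case: (cE x y xZ yZ xy); rewrite cx cy.
have sub : Z \subset \bigcup_(i in [set: 'I_k]) cl i.
  apply/subsetP => x xZ; apply/bigcupP.
  by exists (Ordinal (ck x xZ)); rewrite ?inE ?xZ /=.
have : #|Z| <= k * beta.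
  apply: leq_trans (subset_leq_card sub) _.
  apply: leq_trans (leq_card_bigcup _ _) _.
  rewrite -[k in k * _]card_ord -cardsT -sum_nat_const.
  by apply: leq_sum => i _; rewrite ltnW // ltnNge small.
(* The summand [N > 0] of [nbound] makes the pigeonhole strict. *)
by move: NZ; rewrite mulnC; lia.
Qed.

Lemma containsK_in2_edge (V : finType) (E : rel V) t (S : {set V}) :
  0 < t -> containsK_in E S 2 t -> exists x y, [/\ x \in S, y \in S & E x y].
Proof.
move=> t0 /containsK_in_parts[A [B [sA sB [_ [cA [cB cAB]]]]]].
have /card_gt0P[x xA] : 0 < #|A| by rewrite cA.
have /card_gt0P[y yB] : 0 < #|B| by rewrite cB.
by exists x, y; split; [apply: (subsetP sA) | apply: (subsetP sB) | apply: cAB].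
Qed.

Lemma containsK_tau (V : finType) (E : rel V) t :
  containsK E 2 t -> t <= tau E 2.
Proof.
(* [tau] only ranges up to [#|V|]; a part of size [t] shows that [t] is in range. *)
move=> Kt; have tV : t < #|V|.+1.
  have [A [B [_ _ [_ [<- _]]]]] := containsK_in_parts Kt.
  by rewrite ltnS max_card.
exact: (@leq_bigmax_cond _ (fun t : 'I_#|V|.+1 => containsK E 2 t) _ (Ordinal tV)).
Qed.

Lemma chi_in_FT (W : finType) (ET : rel W) (V : finType) (E : rel V) a b t d :
  simple_graph E -> 0 < t ->
  (forall s (S : {set V}), 0 < s -> ~~ containsK_in E S 2 s ->
     colorable_on E S (a * s ^ b)) ->
  in_FT ET t E -> ~~ containsK E d t ->
  chi E <= a * t ^ b + a * nbound a b (beta ET t) t d ^ b.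
Proof.
move=> sE t0 col; set N := nbound _ _ _ _ _ => FT nKd.
have NB : t + beta ET t <= N by apply: nbound_ge.
case: FT => [small|[_ parts]].
  apply: leq_trans (leq_addr _ _); apply: chi_colorable_on; apply: (col) => //.
  by apply/negP => /containsK_tau; rewrite leqNgt small.
apply: leq_trans (leq_addl _ _); apply: chi_colorable_on; apply: (col).
  by lia.
apply: contra nKd => /containsK_in_parts[A [B [_ _ [dAB [cA [cB cAB]]]]]].
have large (S : {set V}) : #|S| = N ->
    (forall S' : {set V}, S' \subset S -> #|S'| = beta ET t -> containsK_in E S' 2 t) ->
    containsK E d t.
  move=> cS KS; apply: (containsK_inS (subsetT S)).
  apply: (containsK_in_large (beta := beta ET t) sE t0 col); last by rewrite cS.
  by move=> S' sS' cS'; apply: containsK_in2_edge t0 (KS _ sS' cS').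
(* An [A'] without [K_2(t)] forms a [K_2(beta ET t)] with every equally large subset of [B], so each
   of these contains [K_2(t)]. If there is no such [A'], the set [A] itself serves. *)
have [/existsP[A' /and3P[sA' /eqP cA' nA']]|noA] :=
  boolP [exists A' : {set V}, [&& A' \subset A, #|A'| == beta ET t & ~~ containsK_in E A' 2 t]].
  apply: (large B cB) => B' sB' cB'.
  have [||//] := parts A' B'; last by rewrite (negbTE nA').
  split; last split=> //; last split=> //.
    by apply: disjointWl sA' (disjointWr sB' dAB).
  by move=> x y /(subsetP sA') xA /(subsetP sB'); apply: cAB.
apply: (large A cA) => A' sA' cA'; apply: contraNT noA => nA'.
by apply/existsP; exists A'; rewrite sA' cA' eqxx.
Qed.

(** * The polynomial bound on the chromatic number *)

Import Order.TTheory GRing.Theory Num.Theory.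
Local Open Scope ring_scope.

Theorem theorem11 (d : nat) (W : finType) (ET : rel W) :
  (1 <= d)%N -> is_tree ET ->
  exists f : {poly rat},
    forall t : nat, (1 <= t)%N ->
    forall (V : finType) (E : rel V),
      simple_graph E ->
      in_FT ET t E -> T_free ET E -> ~~ containsK E d t ->
      (chi E)%:R <= f.[t%:R].
Proof.
move=> _ treeET; have [a [b col]] := poly_colorable_T_free treeET.
have [c [e ce]] : poly_bounded
    (fun t => a * t ^ b + a * nbound a b (beta ET t) t d ^ b)%N.
  apply: poly_boundedD; apply: poly_boundedM; try exact: poly_bounded_const.
    exact: poly_boundedX poly_bounded_id.
  by apply: poly_boundedX; apply: poly_bounded_nbound; apply: poly_bounded_beta.
exists (c%:R *: 'X^e) => t t0 V E sE FT Tf nK.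
rewrite hornerZ hornerXn -natrX -natrM ler_nat.
apply: leq_trans (ce t t0).
exact: (chi_in_FT sE t0 (col V E sE Tf) FT nK).
Qed.
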